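(* For every graph $H$ and every $\varepsilon>0$, there exists $N\ge 1$ such that for every $H$-free graph $G$, the vertex set $V(G)$ can be partitioned into at most $N$ sets, each of which is weakly $\varepsilon$-restricted. Moreover, $H$ has the polynomial Rödl property if and only if there is a constant $C_H>0$ such that for every $0<\varepsilon\le 1/2$ one may take $N=(1/\varepsilon)^{C_H}$ in the preceding statement.
   Context: All graphs are finite and simple. A graph $G$ is $H$-free if it contains no induced subgraph isomorphic to $H$. For $\varepsilon>0$, a set $S\subseteq V(G)$ is weakly $\varepsilon$-restricted if one of $G[S]$, $\overline{G}[S]$ (induced subgraphs of $G$ and of its complement on $S$) has at most $\varepsilon|S|^2$ edges. A graph $H$ has the polynomial Rödl property if there exists a constant $C_H>0$ such that for all $0<\varepsilon\le 1/2$ and every $H$-free graph $G$ there is a weakly $\varepsilon$-restricted set $S\subseteq V(G)$ with $|S|\ge \varepsilon^{C_H}|G|$. *)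

(* Defs.v *)
From HB Require Import structures.
From mathcomp Require Import all_boot all_order all_algebra.
From mathcomp Require Import reals exp.

Set Implicit Arguments.
Unset Strict Implicit.
Unset Printing Implicit Defensive.

Import Order.TTheory GRing.Theory Num.Theory.
Local Open Scope ring_scope.

Record sgraph := SGraph {
  vertex :> finType;
  edge : rel vertex;
  edge_sym : symmetric edge;
  edge_irr : irreflexive edge
}.

Arguments edge {s} : rename.

Section Operations.
Variable G : sgraph.

Definition compl_edge : rel G := [rel x y | (x != y) && ~~ edge x y].

Fact compl_edge_sym : symmetric compl_edge.
Proof. by move=> x y; rewrite /compl_edge /= eq_sym edge_sym. Qed.

Fact compl_edge_irr : irreflexive compl_edge.
Proof. by move=> x; rewrite /compl_edge /= eqxx. Qed.

Definition compl : sgraph := SGraph compl_edge_sym compl_edge_irr.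

Variable S : {set G}.

Definition induced_edge : rel {x : G | x \in S} :=
  [rel x y | edge (val x) (val y)].

Fact induced_edge_sym : symmetric induced_edge.
Proof. by move=> x y; rewrite /induced_edge /= edge_sym. Qed.

Fact induced_edge_irr : irreflexive induced_edge.
Proof. by move=> x; rewrite /induced_edge /= edge_irr. Qed.

Definition induced : sgraph := SGraph induced_edge_sym induced_edge_irr.

Definition edges : {set {set G}} :=
  [set [set p.1; p.2] | p in [pred p : G * G | edge p.1 p.2]].

End Operations.

Definition isomorphic (G H : sgraph) : Prop :=
  exists f : G -> H,
    bijective f /\ (forall x y, edge (f x) (f y) = edge x y).

Definition is_free (H G : sgraph) : Prop :=
  forall S : {set G}, ~ isomorphic (induced S) H.

Definition weakly_restricted (R : realType) (eps : R) (G : sgraph)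
    (S : {set G}) : Prop :=
  #|edges (induced S)|%:R <= eps * #|S|%:R ^+ 2
  \/ #|edges (@induced (compl G) S)|%:R <= eps * #|S|%:R ^+ 2.

Definition polynomial_rodl (R : realType) (H : sgraph) : Prop :=
  exists C : R, 0 < C /\
    forall eps : R, 0 < eps -> eps <= 1 / 2 ->
    forall G : sgraph, is_free H G ->
    exists S : {set G},
      weakly_restricted eps S /\ eps `^ C * #|G|%:R <= #|S|%:R.

(* The bound N is real so that the same predicate covers N = (1 / eps) `^ C. *)
Definition restricted_partitions (R : realType) (H : sgraph) (eps N : R)
    : Prop :=
  forall G : sgraph, is_free H G ->
  exists P : {set {set G}},
    [/\ partition P [set: G], #|P|%:R <= N
      & forall S : {set G}, S \in P -> weakly_restricted eps S].

(* Main.v *)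
(* Rodl's theorem is proved without the regularity lemma. A failed greedy
   embedding of [H] yields linear-size disjoint sets [A], [B] such that each
   vertex of [A] has few neighbours (or few non-neighbours) in [B]. Sparse
   subsets of [A] and [B] of equal size and density [3/2 t] then have a union of
   density at most [t], so the two target densities, one for the graph and one
   for its complement, can be lowered alternately from the trivial value [1].
   For the partition, restricted sets are split off one after the other; when
   the leftover is tiny compared with the first set it is absorbed by that set.
   If each set is a [d]-fraction of the leftover, about [1 / (eps d^2)] of them
   suffice, which is polynomial in [1 / eps] whenever [d] is. *)

Require Import Defs.
From HB Require Import structures.
From mathcomp Require Import all_boot all_order all_algebra.
From mathcomp Require Import reals exp.
From mathcomp Require Import ring lra zify.

Set Implicit Arguments.
Unset Strict Implicit.
Unset Printing Implicit Defensive.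

Import Order.TTheory GRing.Theory Num.Theory.
Local Open Scope ring_scope.

(** * Counting ordered adjacent pairs *)

Lemma sum_setU (T : finType) (A B : {set T}) (F : T -> nat) :
  [disjoint A & B] ->
  (\sum_(x in A :|: B) F x = \sum_(x in A) F x + \sum_(x in B) F x)%N.
Proof.
move=> dAB; rewrite -bigU //=.
by apply: eq_bigl => x; rewrite !inE.
Qed.

Lemma sum_bool_card (T : finType) (A : {set T}) (p : pred T) :
  (\sum_(x in A) p x)%N = #|[set x in A | p x]|.
Proof.
rewrite -sum1_card big_mkcond [RHS]big_mkcond /=.
by apply: eq_bigr => x _; rewrite inE; case: (x \in A); case: (p x).
Qed.

Section PairCount.
Variables (T : finType) (e : rel T).
Implicit Types X Y Z : {set T}.

(** Pairs are ordered: for symmetric irreflexive [e], [cnt X X] is twice the number of edges, and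
    the count is additive over disjoint unions in each argument. *)
Definition cnt X Y : nat := (\sum_(x in X) \sum_(y in Y) e x y)%N.

Lemma cnt_sym X Y : symmetric e -> cnt X Y = cnt Y X.
Proof.
move=> es; rewrite /cnt exchange_big /=.
by apply: eq_bigr => x _; apply: eq_bigr => y _; rewrite es.
Qed.

Lemma cntUl X Y Z : [disjoint X & Y] -> cnt (X :|: Y) Z = (cnt X Z + cnt Y Z)%N.
Proof. by move=> dXY; rewrite /cnt sum_setU. Qed.

Lemma cntUr X Y Z : [disjoint X & Y] -> cnt Z (X :|: Y) = (cnt Z X + cnt Z Y)%N.
Proof.
move=> dXY; rewrite /cnt -big_split /=; apply: eq_bigr => z _.
by rewrite sum_setU.
Qed.

Lemma cnt_le_mul X Y : (cnt X Y <= #|X| * #|Y|)%N.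
Proof.
rewrite /cnt -sum_nat_const; apply: leq_sum => x _.
by rewrite -sum1_card; apply: leq_sum => y _; case: (e x y).
Qed.

Lemma cnt_subset X X' Y Y' :
  X \subset X' -> Y \subset Y' -> (cnt X Y <= cnt X' Y')%N.
Proof.
move=> sX sY; rewrite /cnt [X in (_ <= X)%N](big_setID X) /=.
rewrite (setIidPr sX); apply: leq_trans (leq_addr _ _).
apply: leq_sum => x _; rewrite [X in (_ <= X)%N](big_setID Y) /=.
by rewrite (setIidPr sY) leq_addr.
Qed.

Lemma cnt_card X Y :
  cnt X Y = #|[set p : T * T | [&& p.1 \in X, p.2 \in Y & e p.1 p.2]]|.
Proof.
rewrite /cnt pair_big_dep /= -sum1_card big_mkcond [RHS]big_mkcond /=.
apply: eq_bigr => -[x y] _ /=; rewrite inE /=.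
by case: (x \in X); case: (y \in Y); case: (e x y).
Qed.

Lemma cnt_setD1 X x : symmetric e -> irreflexive e -> x \in X ->
  cnt X X = (cnt (X :\ x) (X :\ x) + 2 * \sum_(y in X) e x y)%N.
Proof.
move=> es ei xX.
have dx : [disjoint [set x] & X :\ x] by rewrite disjoints1 !inE eqxx.
have c1 Y : cnt [set x] Y = (\sum_(y in Y) e x y)%N by rewrite /cnt big_set1.
have E : (\sum_(y in X) e x y = cnt [set x] (X :\ x))%N.
  by rewrite c1 (big_setD1 x xX) /= ei.
rewrite -{1 2}(setD1K xX) cntUl // !cntUr // E (cnt_sym (X :\ x) _ es).
by rewrite c1 big_set1 ei; lia.
Qed.

Lemma exists_large_degree X : X != set0 ->
  exists2 x, x \in X & (cnt X X <= #|X| * \sum_(y in X) e x y)%N.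
Proof.
case/set0Pn=> x0 x0X.
have [x xX xmax] := @arg_maxnP _ x0 (mem X) (fun x => \sum_(y in X) e x y)%N x0X.
exists x => //; rewrite /cnt -sum_nat_const.
by apply: leq_sum => y yX; apply: xmax.
Qed.

(* Deleting a vertex of maximal degree does not increase the density, since
   [s * (s - 2) <= (s - 1) ^ 2]. *)
Lemma trim_sparse (R : realFieldType) (t : R) X m :
  symmetric e -> irreflexive e -> (m <= #|X|)%N ->
  (cnt X X)%:R <= t * #|X|%:R ^+ 2 ->
  exists Y : {set T}, [/\ Y \subset X, #|Y| = m
    & (cnt Y Y)%:R <= t * m%:R ^+ 2].
Proof.
move=> es ei; have [k Ek] : exists k, (#|X| - m)%N = k by exists (#|X| - m)%N.
elim: k X Ek => [|k IH] X Ek mX cX.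
  by exists X; have -> : m = #|X| by [lia]; split.
have X0 : X != set0 by rewrite -card_gt0; lia.
have [x xX dx] := exists_large_degree X0.
have cardX : #|X| = #|X :\ x|.+1 by rewrite (cardsD1 x) xX.
case: (IH (X :\ x)); [lia|lia| |move=> Y [YX Ym Yc]].
  have := cnt_setD1 es ei xX; move: dx cX.
  rewrite cardX; set c := cnt X X; set c' := cnt (X :\ x) _.
  set d := (\sum_(y in X) _)%N; set s := #|X :\ x|.
  move=> dx cX Ec.
  have [s0|s0] := posnP s.
    have : (c' <= s * s)%N by apply: cnt_le_mul.
    by rewrite s0 leqn0 => /eqP ->; rewrite expr0n /= mulr0.
  have dxR : c%:R <= (s%:R + 1) * d%:R :> R.
    by rewrite natr1 -natrM ler_nat.
  have EcR : c%:R = c'%:R + 2 * d%:R :> R by rewrite Ec natrD natrM.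
  have sR : 1 <= s%:R :> R by rewrite ler1n.
  have c0 : 0 <= c%:R :> R by [].
  rewrite -natr1 in cX.
  (* The sign of [t] is forced: a negative [t] would make the count [c] negative. *)
  have t0 : 0 <= t.
    rewrite leNgt; apply/negP => t0; have : t * (s%:R + 1) ^+ 2 < 0.
      by rewrite nmulr_rlt0 // exprn_gt0 //; lra.
    lra.
  (* Since [c = c' + 2 * d] and [d >= c / (s + 1)], deleting [x] leaves at most a fraction
     [(s - 1) / (s + 1)] of the pairs. *)
  have H1 : (s%:R + 1) * c'%:R <= (s%:R - 1) * c%:R :> R by rewrite EcR in dxR *; nra.
  have H2 : (s%:R - 1) * c%:R <= (s%:R - 1) * (t * (s%:R + 1) ^+ 2).
    by apply: ler_wpM2l cX; lra.
  have H3 : c'%:R <= (s%:R - 1) * (t * (s%:R + 1)) :> R.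
    rewrite -(@ler_pM2l _ (s%:R + 1)); last by lra.
    apply: le_trans H1 _; apply: le_trans H2 _; rewrite le_eqVlt; apply/orP; left.
    by apply/eqP; ring.
  apply: le_trans H3 _; rewrite -subr_ge0.
  by have -> : t * s%:R ^+ 2 - (s%:R - 1) * (t * (s%:R + 1)) = t by ring.
by exists Y; split=> //; apply: subset_trans YX (subsetDl _ _).
Qed.

End PairCount.

(** * Greedy embedding of [H] and the sparse pair *)

Lemma subset_of_card (T : finType) (A : {set T}) m : (m <= #|A|)%N ->
  exists2 B : {set T}, B \subset A & #|B| = m.
Proof.
move=> mA; exists [set x in take m (enum A)].
  by apply/subsetP => x; rewrite inE => /mem_take; rewrite mem_enum.
rewrite cardsE (card_uniqP _) ?take_uniq ?enum_uniq //.
by rewrite size_take -cardE; case: ltnP => //; lia.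
Qed.

Lemma disjoint_blocks (T I : finType) (s : seq I) (U : {set T}) q :
  uniq s -> (size s * q <= #|U|)%N ->
  exists V : I -> {set T}, [/\ forall i, V i \subset U,
    forall i j, i != j -> [disjoint V i & V j] & forall i, i \in s -> #|V i| = q].
Proof.
elim: s U => [|v s IH] U /=.
  (* Indices outside the list get the empty block, so inclusion and disjointness hold for all
     indices. *)
  move=> _ _; exists (fun=> set0); split=> // [i|i j _]; first exact: sub0set.
  by rewrite -setI_eq0 set0I.
move=> /andP[vs us] sz.
have [|B BU cB] := @subset_of_card _ U q; first by nia.
have [|V [VU Vd Vc]] := IH (U :\: B) us.
  by rewrite cardsD (setIidPr BU) cB; nia.
have dB i : [disjoint V i & B].
  by apply: disjointWl (VU i) _; rewrite -setI_eq0 setIDAC setDIl setDv setI0.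
exists (fun i => if i == v then B else V i); split.
- by move=> i; case: eqP => // _; apply: subset_trans (VU i) (subsetDl _ _).
- move=> i j ij; case: (i =P v) ij => [->|_]; case: (j =P v) => [->|_] //.
  + by rewrite eqxx.
  + by rewrite disjoint_sym.
  + exact: Vd.
- by move=> i; rewrite inE; case: eqP => [_ _|_ /= /Vc].
Qed.

Section Colour.
Variable G : sgraph.

(** Edges and non-edges are two colours, so that one argument serves both the graph and its
    complement. *)
Definition col_edge (b : bool) : rel G := if b then edge else @compl_edge G.

Lemma col_edge_sym b : symmetric (col_edge b).
Proof. by case: b; [apply: edge_sym|apply: compl_edge_sym]. Qed.

Lemma col_edge_irr b : irreflexive (col_edge b).
Proof. by case: b; [apply: edge_irr|apply: compl_edge_irr]. Qed.

Lemma col_edge_inj b x y : x != y -> col_edge b x y -> edge x y = b.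
Proof. by case: b => //= xy; rewrite /compl_edge /= xy => /negbTE. Qed.

End Colour.
Arguments col_edge {G}.

(** Corestricted to its image, [phi] is a bijection by cardinality, and its inverse is the
    isomorphism that freeness forbids. *)
Lemma embedding_not_free (H G : sgraph) (phi : H -> G) : injective phi ->
  (forall i j, i != j -> edge (phi i) (phi j) = edge i j) -> ~ is_free H G.
Proof.
move=> phi_inj phiE /(_ (phi @: setT)); apply.
have phiS i : phi i \in phi @: setT by apply: imset_f.
pose g (i : H) : induced (phi @: setT) := exist _ (phi i) (phiS i).
have g_inj : injective g by move=> i j [] /phi_inj.
have gE i j : edge (g i) (g j) = edge i j.
  by have [->|/phiE //] := eqVneq i j; rewrite !edge_irr.
have /(inj_card_bij g_inj) : (#|induced (phi @: setT)| <= #|H|)%N.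
  by rewrite card_sig card_imset // cardsT.
case=> f gf fg; exists f; split; first by exists g.
by move=> x y; rewrite -gE !fg.
Qed.

Lemma cover_pigeonhole (T : finType) (I : eqType) (s : seq I)
    (F : I -> {set T}) (V : {set T}) :
  V != set0 -> (forall x, x \in V -> has (fun j => x \in F j) s) ->
  exists2 j, j \in s & (#|V| <= size s * #|F j|)%N.
Proof.
move=> V0 Vs.
have bound a (W : {set T}) r : (forall x, x \in W -> has (fun j => x \in F j) r) ->
    (forall j, j \in r -> #|F j| <= a)%N -> (#|W| <= size r * a)%N.
  elim: r W => [|j r IH] W Wr Fa.
    by rewrite leqn0 cards_eq0; apply/set0Pn => -[x /Wr].
  rewrite -(cardsID (F j)) /= mulSn leq_add //.
    by apply: leq_trans (Fa j (mem_head _ _)); rewrite subset_leq_card ?subsetIr.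
  apply: IH => [x|i ir]; last by rewrite Fa // inE ir orbT.
  by rewrite inE => /andP[/negbTE xF /Wr]; rewrite /= xF.
apply/hasP; apply/negPn/negP => /hasPn small.
have s0 : (0 < size s)%N.
  by case/set0Pn: V0 => x /Vs /hasP[j js _]; case: (s) js.
move: V0; rewrite -card_gt0 => V0.
(* If the claim fails for every [j], each [#|F j|] is at most this quotient, the largest [a] with
   [size s * a < #|V|]. *)
suff : (#|V| <= size s * (#|V|.-1 %/ size s))%N.
  by rewrite leqNgt mulnC (leq_ltn_trans (leq_trunc_div _ _)) ?prednK.
apply: bound => // j /small; rewrite -ltnNge => Fj.
by rewrite leq_divRL // mulnC; lia.
Qed.

(* Greedy embedding: either the next vertex of [H] can be placed so that every
   remaining candidate set keeps a [c]-fraction, or many vertices fail for one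
   and the same candidate set, which yields the pair [(A, B)]. *)
Lemma greedy_embedding (R : realFieldType) (H G : sgraph) (c : R) (K : nat)
    (s : seq H) (M : R) (V : H -> {set G}) (x0 : G) :
  0 < c -> c <= 1 -> (size s <= K)%N -> uniq s -> 0 < M ->
  (forall i j, i != j -> [disjoint V i & V j]) ->
  (forall i, i \in s -> M <= #|V i|%:R) ->
  (exists phi : H -> G, forall i, i \in s -> phi i \in V i /\
     forall j, j \in s -> i != j -> col_edge (edge i j) (phi i) (phi j))
  \/ exists b i j (A B : {set G}), [/\ i != j, A \subset V i /\ B \subset V j,
       c ^+ K * M <= K%:R * #|A|%:R, c ^+ K * M <= K%:R * #|B|%:R
     & forall x, x \in A -> (\sum_(y in B) col_edge b x y)%:R <= c * #|B|%:R].
Proof.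
move=> c0 c1; elim: s K M V => [|v s IH] K M V /=; first by left; exists (fun=> x0).
case: K => // K sK /andP[vs us] M0 Vd VM.
(* [N x j] is what remains of the candidates for [j] once [v] is placed at [x]; [bad j] collects the
   placements that leave at most a [c]-fraction of them. *)
pose N x j := [set y in V j | col_edge (edge v j) x y].
pose bad j := [set x in V v | #|N x j|%:R <= c * #|V j|%:R].
have [/existsP[x /andP[xV /allP good]]|] :=
    boolP [exists x, (x \in V v) && all (fun j => x \notin bad j) s].
- case: (IH K (c * M) (N x) sK us); first exact: mulr_gt0.
  + move=> i j /Vd; apply: disjointW; apply/subsetP => y; rewrite inE => /andP[] //.
  + move=> j js; have := good j js; rewrite inE xV /= -ltNge => /ltW; apply: le_trans.
    by rewrite ler_pM2l // VM // inE js orbT.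
  + move=> [phi phiP]; left; exists (fun i => if i == v then x else phi i) => i.
    have key j : j \in s -> phi j \in V j /\ col_edge (edge v j) x (phi j).
      by move=> /phiP[]; rewrite inE => /andP[].
    rewrite inE; have [->{i} _|iv /= is_] := eqVneq i v.
      split=> // j; rewrite inE eq_sym; have [//|jv /= js _] := eqVneq j v.
      exact: (key j js).2.
    split; first exact: (key i is_).1.
    move=> j; rewrite inE; have [->{j} _ _|jv /= js ij] := eqVneq j v.
      by rewrite edge_sym col_edge_sym; apply: (key i is_).2.
    exact: (phiP i is_).2.
  + move=> [b [i [j [A [B [ij [AV BV] cA cB deg]]]]]]; right.
    have sub k : N x k \subset V k by apply/subsetP => y; rewrite inE => /andP[].
    have up (n : nat) : c ^+ K * (c * M) <= K%:R * n%:R -> c ^+ K.+1 * M <= K.+1%:R * n%:R.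
      move=> h; rewrite exprSr -mulrA; apply: le_trans h _.
      by rewrite ler_wpM2r // ler_nat.
    exists b, i, j, A, B; split=> //; try exact: up.
    by split; [apply: subset_trans AV _|apply: subset_trans BV _].
- move=> /existsPn nogood; right.
  have V0 : V v != set0.
    rewrite -card_gt0 -(ltr_nat R); apply: lt_le_trans M0 _.
    by apply: VM; rewrite inE eqxx.
  have [x xV|j js big] := @cover_pigeonhole _ _ s bad (V v) V0.
    have := nogood x; rewrite xV /= => /allPn[j js]; rewrite negbK => xb.
    by apply/hasP; exists j.
  have cK : c ^+ K.+1 * M <= M by rewrite ler_piMl ?exprn_ile1 // ltW.
  exists (edge v j), v, j, (bad j), (V j); split.
  + by apply: contraNneq vs => ->.
  + by split=> //; apply/subsetP => x; rewrite inE => /andP[].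
  + apply: le_trans cK _; apply: le_trans (VM v (mem_head _ _)) _.
    rewrite -natrM ler_nat; apply: leq_trans big _; rewrite leq_mul2r; apply/orP; right.
    exact: ltnW.
  + apply: le_trans cK _; apply: (le_trans (VM j _)); first by rewrite inE js orbT.
    by rewrite ler_peMl // ler1n.
  + by move=> x; rewrite inE sum_bool_card => /andP[].
Qed.

(** Cut [U] into [#|H|] disjoint blocks of equal size and try to embed one vertex of [H] in each.
    Success would be an induced copy of [H], so the greedy embedding fails and leaves the pair. *)
Lemma free_sparse_pair (R : realFieldType) (H : sgraph) (c : R) :
  0 < c -> c <= 1 -> exists eta : R, [/\ 0 < eta, eta <= 1 &
  forall G : sgraph, is_free H G -> forall U : {set G}, 1 <= eta * #|U|%:R ->
  exists b (A B : {set G}), [/\ A \subset U /\ B \subset U, [disjoint A & B],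
    eta * #|U|%:R <= #|A|%:R, eta * #|U|%:R <= #|B|%:R
  & forall x, x \in A -> (\sum_(y in B) col_edge b x y)%:R <= c * #|B|%:R]].
Proof.
move=> c0 c1; set K := #|H|.
have [K0|K0] := posnP K.
  (* The graph without vertices embeds in every graph, so no graph is [H]-free. *)
  exists 1; split=> // G freeG U U1; exfalso.
  have Hvoid (i : H) : False by have := card0_eq K0 i; rewrite !inE.
  by apply: (@embedding_not_free H G (fun i => False_rect _ (Hvoid i))) freeG => i.
have K0R : 1 <= K%:R :> R by rewrite ler1n.
have cK0 : 0 < c ^+ K by rewrite exprn_gt0.
have cK1 : c ^+ K <= 1 by rewrite exprn_ile1 // ltW.
have KK : 1 <= K%:R * K%:R :> R by rewrite -natrM ler1n muln_gt0 K0.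
(* A block has size [q >= #|U| / (2 * K)], the 2 paying for rounding, and a failed embedding keeps a
   [c ^+ K / K] fraction of a block. *)
pose eta := c ^+ K / (2 * K%:R * K%:R).
have etaE : eta * K%:R * K%:R * 2 = c ^+ K by rewrite /eta; field; lra.
have eta0 : 0 < eta by rewrite divr_gt0 // -mulrA mulr_gt0 //; lra.
have etaK : eta * K%:R <= 1.
  have : eta * K%:R <= eta * K%:R * K%:R by rewrite ler_peMr // mulr_ge0 // ltW.
  lra.
exists eta; split=> //.
  have : eta <= eta * K%:R by rewrite ler_peMr // ltW.
  lra.
move=> G freeG U U1.
pose q := (#|U| %/ K)%N.
have KU : (K <= #|U|)%N.
  rewrite -(ler_nat R); have := ler_wpM2l (ler0n R K) U1; rewrite mulr1 => h.
  apply: le_trans h _; rewrite mulrA [K%:R * _]mulrC; apply: ler_piMl => //.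
have q0 : (0 < q)%N by rewrite divn_gt0.
have qU : #|U|%:R <= 2 * K%:R * q%:R :> R.
  rewrite -!natrM ler_nat; have := ltn_ceil #|U| K0; rewrite -/q; nia.
have [x0 _] : exists x0 : G, x0 \in U.
  by apply/set0Pn; rewrite -card_gt0; apply: leq_trans K0 KU.
have [|V [VU Vd Vq]] := @disjoint_blocks _ _ (enum H) U q (enum_uniq _).
  by rewrite -cardE mulnC leq_trunc_div.
case: (@greedy_embedding R H G c K (enum H) q%:R V x0 c0 c1).
- by rewrite -cardE.
- exact: enum_uniq.
- by rewrite ltr0n.
- exact: Vd.
- by move=> i /Vq ->.
- move=> [phi phiP]; have phiV i : phi i \in V i by apply: (phiP i _).1; rewrite mem_enum.
  have phi_inj : injective phi.
    move=> i j eij; apply: contraTeq (phiV i) => /Vd /pred0P /(_ (phi i)) /=.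
    by have := phiV j; rewrite -eij => ->; rewrite andbT => ->.
  exfalso; apply: (embedding_not_free phi_inj _ freeG) => i j ij.
  apply: col_edge_inj; first by rewrite (inj_eq phi_inj).
  by apply: (phiP i _).2; rewrite ?mem_enum.
- move=> [b [i [j [A [B [ij [AV BV] cA cB deg]]]]]].
  have up (n : nat) : c ^+ K * q%:R <= K%:R * n%:R -> eta * #|U|%:R <= n%:R.
    move=> h; rewrite -(@ler_pM2l _ K%:R); last by lra.
    apply: le_trans h; rewrite -etaE.
    have eK : 0 <= eta * K%:R by rewrite mulr_ge0 // ltW.
    have := ler_wpM2l eK qU; lra.
  exists b, A, B; split; [|exact: disjointW (Vd _ _ ij)|exact: up|exact: up|exact: deg].
  by split; [apply: subset_trans AV _|apply: subset_trans BV _].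
Qed.

(** * Lowering the two target densities *)

(** The degree bound concerns all of [B] and need not pass to a subset. Hence [A'] is chosen first,
    and [B'] only among the vertices of [B] with few [b]-neighbours in [A']. If either set is
    already sparse in the other colour, it serves as [S]. *)
Lemma sparse_pair_step (R : realFieldType) (G : sgraph) (b : bool)
    (A B : {set G}) (c : R) (t : bool -> R) (m : nat) :
  0 < c -> 4 * c <= t b -> [disjoint A & B] ->
  (forall x, x \in A -> (\sum_(y in B) col_edge b x y)%:R <= c * #|B|%:R) ->
  (forall X : {set G}, (#|A| <= #|X|)%N \/ (#|B| <= 2 * #|X|)%N ->
   exists S : {set G}, [/\ S \subset X, #|S| = m &
     (cnt (col_edge b) S S)%:R <= 3 / 2 * t b * m%:R ^+ 2 \/
     (cnt (col_edge (~~ b)) S S)%:R <= t (~~ b) * m%:R ^+ 2]) ->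
  exists S : {set G}, [/\ S \subset A :|: B, #|S| = m &
    exists b', (cnt (col_edge b') S S)%:R <= t b' * m%:R ^+ 2].
Proof.
move=> c0 ct dAB deg large; case: (posnP m) => [->|m0].
  exists set0; split; rewrite ?sub0set ?cards0 //; exists true.
  by rewrite /cnt big_set0 expr0n mulr0.
have [|A' [A'A A'm [A's|A'd]]] := large A; [by left| |]; last first.
  exists A'; split=> //; last by exists (~~ b).
  by apply: subset_trans A'A (subsetUl _ _).
have m0R : 0 < m%:R :> R by rewrite ltr0n.
set e := col_edge b in deg A's *.
have es : symmetric e := @col_edge_sym G b.
have ei : irreflexive e := @col_edge_irr G b.
pose d y := (\sum_(x in A') e y x)%N.
pose B1 := [set y in B | (d y)%:R <= 2 * c * m%:R].
have B1B : B1 \subset B by apply/subsetP => y; rewrite inE => /andP[].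
(* Markov's inequality: on average a vertex of [B] has at most [c * m] neighbours in [A'], so at
   most half of [B] exceeds twice that. *)
have B1large : (#|B| <= 2 * #|B1|)%N.
  have up : (cnt e A' B)%:R <= m%:R * (c * #|B|%:R).
    rewrite /cnt natr_sum -A'm mulr_natl -sumr_const.
    by apply: ler_sum => x /(subsetP A'A) /deg.
  have down : #|B :\: B1|%:R * (2 * c * m%:R) <= (cnt e A' B)%:R.
    rewrite cnt_sym //; apply: (@le_trans _ _ (cnt e (B :\: B1) A')%:R).
      rewrite /cnt natr_sum mulr_natl -sumr_const; apply: ler_sum => y.
      by rewrite !inE => /andP[+ yB]; rewrite yB /= -ltNge => /ltW.
    by rewrite ler_nat cnt_subset // subsetDl.
  have : #|B :\: B1|%:R * 2 <= #|B|%:R :> R.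
    have cm : 0 < c * m%:R by rewrite mulr_gt0.
    rewrite -(ler_pM2r cm); have := le_trans down up; lra.
  rewrite -natrM ler_nat cardsD (setIidPr B1B).
  by have := subset_leq_card B1B; lia.
have [|B' [B'B B'm [B's|B'd]]] := large B1; [by right| |]; last first.
  exists B'; split=> //; last by exists (~~ b).
  apply: subset_trans B'B (subset_trans B1B (subsetUr _ _)).
have dAB' : [disjoint A' & B'].
  by apply: disjointW dAB => //; apply: subset_trans B'B B1B.
have cross : (cnt e B' A')%:R <= m%:R * (2 * c * m%:R).
  rewrite /cnt natr_sum -{1}B'm [_ * (_ * _)]mulr_natl -sumr_const; apply: ler_sum => y.
  by move=> /(subsetP B'B); rewrite inE => /andP[].
have cU : #|A' :|: B'| = (m + m)%N.
  by have := cardsUI A' B'; rewrite (disjoint_setI0 dAB') cards0 A'm B'm; lia.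
have [||S [SU Sm Sc]] := @trim_sparse _ e R (t b) (A' :|: B') m es ei.
- by rewrite cU leq_addr.
(* Two inner counts of [3/2 t m^2] and two cross counts of [2 c m^2], with [4 c <= t], add up to at
   most [4 t m^2 = t (2m)^2]. *)
- rewrite cntUl // !cntUr // cU (cnt_sym A' B' es) !natrD.
  have : 4 * c * m%:R ^+ 2 <= t b * m%:R ^+ 2 by rewrite ler_pM2r // exprn_gt0.
  move: A's B's cross; lra.
- exists S; split=> //; last by exists b.
  apply: subset_trans SU (setUSS A'A (subset_trans B'B B1B)).
Qed.

(** Each colour has its own target density. Every size [m] up to the bound must be attained exactly,
    so that two sets of equal size can be joined. *)
Definition has_linear_restricted (R : realFieldType) (H : sgraph)
    (t : bool -> R) : Prop :=
  exists delta : R, [/\ 0 < delta, delta <= 1 &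
  forall G : sgraph, is_free H G -> forall (U : {set G}) (m : nat),
  m%:R <= delta * #|U|%:R ->
  exists S : {set G}, [/\ S \subset U, #|S| = m &
    exists b, (cnt (col_edge b) S S)%:R <= t b * m%:R ^+ 2]].

Lemma has_linear_restricted_step (R : realFieldType) (H : sgraph)
    (t : bool -> R) :
  (forall b, 0 < t b) ->
  (forall b, has_linear_restricted H
     (fun b' => if b' == b then 3 / 2 * t b else t b')) ->
  has_linear_restricted H t.
Proof.
move=> t0 IH.
have [d [d0 d1 dP]] : exists d : R, [/\ 0 < d, d <= 1 &
    forall b (G : sgraph), is_free H G -> forall (U : {set G}) (m : nat),
    m%:R <= d * #|U|%:R -> exists S : {set G}, [/\ S \subset U, #|S| = m &
     (cnt (col_edge b) S S)%:R <= 3 / 2 * t b * m%:R ^+ 2 \/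
     (cnt (col_edge (~~ b)) S S)%:R <= t (~~ b) * m%:R ^+ 2]].
  have [dt [dt0 dt1 dtP]] := IH true; have [df [df0 df1 dfP]] := IH false.
  (* The colour of the sparse pair is not known in advance, so [d] must serve both. *)
  exists (Num.min dt df); split; first by rewrite lt_min dt0.
    by rewrite ge_min dt1.
  move=> b G freeG U m mU.
  have [mt mf] : m%:R <= dt * #|U|%:R /\ m%:R <= df * #|U|%:R.
    by split; apply: le_trans mU _; rewrite ler_wpM2r // ge_min lexx ?orbT.
  case: b.
    have [S [SU Sm [[] Sb]]] := dtP G freeG U m mt; exists S; split=> //.
      by left.
    by right.
  have [S [SU Sm [[] Sb]]] := dfP G freeG U m mf; exists S; split=> //.
    by right.
  by left.
pose c := Num.min 1 (Num.min (t true) (t false) / 4).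
have c0 : 0 < c by rewrite lt_min ltr01 divr_gt0 // lt_min !t0.
have c1 : c <= 1 by rewrite ge_min lexx.
have ct b : 4 * c <= t b.
  have : c <= Num.min (t true) (t false) / 4 by rewrite ge_min lexx orbT.
  have : Num.min (t true) (t false) <= t b by case: b; rewrite ge_min lexx ?orbT.
  lra.
have [eta [eta0 eta1 etaP]] := free_sparse_pair H c0 c1.
(* [eta] pays for the pair, [d] for the sparse subset, and 2 for the passage to half of [B]. For
   [m >= 1] this also gives the [1 <= eta * #|U|] that [free_sparse_pair] requires. *)
exists (d * eta / 2); split.
- by rewrite divr_gt0 // mulr_gt0.
- have : d * eta <= 1 by apply: mulr_ile1 => //; apply: ltW.
  have : 0 < d * eta by rewrite mulr_gt0.
  lra.
move=> G freeG U m mU; have [m0|m0] := posnP m.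
  exists set0; split; rewrite ?sub0set ?cards0 //; exists true.
  by rewrite m0 /cnt big_set0 expr0n mulr0.
have m1 : 1 <= m%:R :> R by rewrite ler1n.
have ge0 : 0 <= eta * #|U|%:R by rewrite mulr_ge0 // ltW.
have mU' : m%:R <= d * (eta * #|U|%:R) / 2 by move: mU; rewrite -!mulrA; lra.
have le_eta : d * (eta * #|U|%:R) <= eta * #|U|%:R by rewrite ler_piMl.
have [|b [A [B [[AU BU] dAB cA cB deg]]]] := etaP G freeG U; first by lra.
have [X XAB|S [SAB Sm Sb]] := @sparse_pair_step R G b A B c t m c0 (ct b) dAB deg.
  apply: (dP b G freeG); apply: le_trans mU' _.
  rewrite -mulrA ler_pM2l //; case: XAB => [AX|BX].
    have : #|A|%:R <= #|X|%:R :> R by rewrite ler_nat.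
    lra.
  have : #|B|%:R <= 2 * #|X|%:R :> R by rewrite -natrM ler_nat.
  lra.
exists S; split=> //; apply: subset_trans SAB _.
by apply/subUsetP.
Qed.

Lemma has_linear_restricted_ge1 (R : realFieldType) (H : sgraph)
    (t : bool -> R) b :
  1 <= t b -> has_linear_restricted H t.
Proof.
move=> t1; exists 1; split=> // G _ U m; rewrite mul1r ler_nat => mU.
have [S SU Sm] := subset_of_card mU; exists S; split=> //; exists b; rewrite -Sm.
apply: le_trans (_ : #|S|%:R ^+ 2 <= _); last by rewrite ler_peMl // exprn_ge0.
by rewrite -natrX ler_nat -mulnn cnt_le_mul.
Qed.

(** Raising one target by [3/2] uses up one unit of its exponent. Once an exponent is 0 that target
    is at least 1 and any set will do. *)
Lemma has_linear_restricted_powers (R : realFieldType) (H : sgraph) (n : nat)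
    (t : bool -> R) (k : bool -> nat) :
  (k true + k false)%N = n -> (forall b, (2 / 3) ^+ k b <= t b) ->
  has_linear_restricted H t.
Proof.
have base b (k' : bool -> nat) (t' : bool -> R) :
    k' b = 0%N -> (2 / 3) ^+ k' b <= t' b -> has_linear_restricted H t'.
  by move=> ->; rewrite expr0; apply: has_linear_restricted_ge1.
elim: n t k => [|n IH] t k kn kt; first by apply: (base true k) => //; lia.
have [kt0|kt0] := posnP (k true); first exact: base kt0 (kt _).
have [kf0|kf0] := posnP (k false); first exact: base kf0 (kt _).
apply: has_linear_restricted_step => b.
  by apply: lt_le_trans (kt b); rewrite exprn_gt0 // divr_gt0.
apply: (IH _ (fun b' => if b' == b then (k b).-1 else k b')).
  by case: b => /=; lia.
move=> b'; case: eqP => [_|//]; have := kt b.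
have : (0 < k b)%N by case: b.
by case: (k b) => // j _; rewrite exprS /=; lra.
Qed.

(** Bernoulli's inequality gives [(2/3)^n <= 1 / (1 + n/2)], which is below [eps] once
    [n > 2 / eps]. *)
Lemma pow23_le (R : archiRealFieldType) (eps : R) :
  0 < eps -> exists n, (2 / 3) ^+ n <= eps.
Proof.
move=> e0; pose n := (Num.truncn (2 / eps)).+1; exists n.
have nb : 2 / eps < n%:R by apply: truncnS_gt.
have bern k : (2 / 3) ^+ k * (1 + k%:R / 2) <= 1 :> R.
  elim: k => [|k IH]; first by rewrite expr0; lra.
  have k0 : 0 <= k%:R :> R by [].
  have p0 : 0 <= (2 / 3) ^+ k :> R by rewrite exprn_ge0 // divr_ge0.
  rewrite exprS -(natr1 k); move: IH p0; set p := (2 / 3) ^+ k => IH p0.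
  have : 0 <= p * k%:R by rewrite mulr_ge0.
  lra.
have ne : 2 < n%:R * eps by rewrite -ltr_pdivrMr.
have p0 : 0 <= (2 / 3) ^+ n :> R by rewrite exprn_ge0 // divr_ge0.
have := bern n; move: p0; set p := (2 / 3) ^+ n; move=> p0 pb.
have n0 : 0 <= n%:R :> R by [].
have : p * 2 <= p * (2 * eps + n%:R * eps) by rewrite ler_wpM2l //; lra.
have := ler_wpM2r (ltW e0) pb; lra.
Qed.

(* Rodl's theorem, relative to an arbitrary vertex subset [U]. *)
Lemma rodl (R : archiRealFieldType) (H : sgraph) (eps : R) : 0 < eps ->
  exists delta : R, [/\ 0 < delta, delta <= 1 &
  forall G : sgraph, is_free H G -> forall U : {set G},
  exists S : {set G}, [/\ S \subset U, delta * #|U|%:R <= #|S|%:R &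
    exists b, (cnt (col_edge b) S S)%:R <= eps * #|S|%:R ^+ 2]].
Proof.
move=> e0; have [n ne] := pow23_le e0.
have [d [d0 d1 dP]] := @has_linear_restricted_powers _ H _ (fun=> eps) (fun=> n)
  erefl (fun=> ne).
(* Halving [d] pays for rounding [d * #|U|] down to [m >= 1]. If [m = 0], then [d * #|U| < 1] and a
   single vertex is large enough. *)
exists (d / 2); split; [lra|lra|move=> G freeG U].
have dU : 0 <= d * #|U|%:R by rewrite mulr_ge0 // ltW.
pose m := Num.truncn (d * #|U|%:R).
have [m0|m0] := posnP m; last first.
  have mle : m%:R <= d * #|U|%:R by have /andP[] := truncn_itv dU.
  have mgt : d * #|U|%:R < m%:R + 1 by rewrite natr1 truncnS_gt.
  have m1 : 1 <= m%:R :> R by rewrite ler1n.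
  have [S [SU Sm Sb]] := dP G freeG U m mle; exists S; split=> //; rewrite Sm //.
  by rewrite mulrAC; lra.
have lt1 : d * #|U|%:R < 1 by have := truncnS_gt (d * #|U|%:R); rewrite -/m m0.
have [->|/set0Pn[x xU]] := eqVneq U set0.
  exists set0; split=> //; first by rewrite cards0 mulr0.
  by exists true; rewrite /cnt big_set0 mulr_ge0 // ?exprn_ge0 // ltW.
exists [set x]; split; rewrite ?sub1set ?cards1 //; first by rewrite mulrAC; lra.
by exists true; rewrite /cnt !big_set1 col_edge_irr expr1n mulr1 ltW.
Qed.

(** * Edge counts against ordered pairs, and induced subgraphs *)

Lemma card_le_mul_imset (T T' : finType) (f : T -> T') (D : {set T}) n :
  (forall y, #|[set x in D | f x == y]| <= n)%N -> (#|D| <= n * #|f @: D|)%N.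
Proof.
move=> fib; rewrite -sum1_card (partition_big_imset f) /= mulnC -sum_nat_const.
apply: leq_sum => y _; apply: leq_trans (fib y); rewrite -sum1_card.
by apply: eq_leq; apply: eq_bigl => x; rewrite inE.
Qed.

Section EdgeCount.
Variables (G : sgraph) (S : {set G}).

Lemma cnt_induced :
  cnt edge S S = #|[set p : induced S * induced S | edge p.1 p.2]|.
Proof.
rewrite cnt_card -(card_imset _ (_ : injective (fun p : induced S * induced S =>
  (val p.1, val p.2)))); last first.
  by move=> [a b] [a' b'] [] /val_inj -> /val_inj ->.
congr #|pred_of_set _|; apply/setP => -[x y]; rewrite !inE /=.
apply/idP/imsetP => [/and3P[xS yS xy]|[[a b]]].
  by exists (exist _ x xS, exist _ y yS); rewrite ?inE.
rewrite inE /= => ab [-> ->]; apply/and3P; split; [exact: valP|exact: valP|exact: ab].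
Qed.

Lemma card_edges_le_cnt : (#|edges (induced S)| <= cnt edge S S)%N.
Proof.
rewrite cnt_induced /edges; apply: leq_trans (leq_imset_card _ _) _.
by rewrite subset_leq_card //; apply/subsetP => p; rewrite !inE.
Qed.

(** Only [(a, b)] and [(b, a)] yield the edge [[set a; b]], so the fibres have at most two
    elements. *)
Lemma cnt_le_card_edges : (cnt edge S S <= 2 * #|edges (induced S)|)%N.
Proof.
rewrite cnt_induced /edges; set D := [set p | _].
have -> : [set [set p.1; p.2] | p in [pred p : induced S * induced S | edge p.1 p.2]]
   = [set [set p.1; p.2] | p in D].
  by apply/setP => y; apply/imsetP/imsetP => -[p pD ->]; exists p => //;
    move: pD; rewrite !inE.
apply: card_le_mul_imset => y.
have [->|/set0Pn[[a b]]] := eqVneq [set x in D | [set x.1; x.2] == y] set0.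
  by rewrite cards0.
rewrite !inE /= => /andP[ab /eqP <-].
apply: leq_trans (_ : #|[set (a, b); (b, a)]| <= 2)%N; last first.
  by rewrite cards2; case: eqP.
apply: subset_leq_card; apply/subsetP => -[c d]; rewrite !inE /=.
move=> /andP[cd /eqP E].
have cdn : c != d by apply: contraTneq cd => ->; rewrite induced_edge_irr.
have : c \in [set a; b] by rewrite -E !inE eqxx.
have : d \in [set a; b] by rewrite -E !inE eqxx orbT.
rewrite !inE !xpair_eqE => /orP[] /eqP dE /orP[] /eqP cE; move: cdn;
  by rewrite dE cE !eqxx ?orbT.
Qed.

End EdgeCount.

Lemma weakly_restricted_cnt (R : realType) (eps : R) (G : sgraph) (S : {set G}) :
  weakly_restricted eps S ->
  exists b, (cnt (col_edge b) S S)%:R <= 2 * eps * #|S|%:R ^+ 2.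
Proof.
case=> h; [exists true|exists false].
  have := @cnt_le_card_edges G S; rewrite -(ler_nat R) natrM /=; lra.
have := @cnt_le_card_edges (compl G) S; rewrite -(ler_nat R) natrM /=; lra.
Qed.

Lemma cnt_weakly_restricted (R : realType) (eps : R) (G : sgraph) (S : {set G}) b :
  (cnt (col_edge b) S S)%:R <= eps * #|S|%:R ^+ 2 -> weakly_restricted eps S.
Proof.
case: b => h; [left|right]; apply: le_trans h; rewrite ler_nat.
  exact: card_edges_le_cnt.
exact: (@card_edges_le_cnt (compl G)).
Qed.

(** [polynomial_rodl] speaks of whole graphs, while the partition needs a restricted set inside each
    leftover [U]; [induced U] bridges the two. *)
Lemma free_induced (H G : sgraph) (U : {set G}) :
  is_free H G -> is_free H (induced U).
Proof.
move=> freeG S [f [[g fg gf] fE]].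
pose phi (i : H) : G := val (val (g i)).
apply: (@embedding_not_free H G phi) freeG => [i j /val_inj /val_inj|i j _].
  exact: (can_inj gf).
by rewrite -{2}(gf i) -{2}(gf j) fE.
Qed.

Lemma cnt_col_induced (G : sgraph) (U : {set G}) (S : {set induced U}) b :
  cnt (col_edge b) (val @: S) (val @: S) = cnt (col_edge b) S S.
Proof.
rewrite /cnt big_imset /=; last by move=> x y _ _; apply: val_inj.
apply: eq_bigr => x _; rewrite big_imset /=; last by move=> ? ? _ _; apply: val_inj.
by apply: eq_bigr => y _; case: b.
Qed.

(** * From restricted sets to partitions *)

(** Colour [i < k] marks the set split off at step [i], colour [k] the leftover, which shrinks by a
    factor [1 - d] at each step. *)
Lemma greedy_colouring (R : realFieldType) (T : finType) (Q : {set T} -> Prop)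
    (d : R) :
  0 < d -> d <= 1 ->
  (forall U : {set T}, exists S : {set T},
     [/\ S \subset U, d * #|U|%:R <= #|S|%:R & Q S]) ->
  forall k, exists f : T -> nat,
  [/\ forall x, (f x <= k)%N, forall i, (i < k)%N -> Q [set x | f x == i],
      #|[set x | f x == k]|%:R <= (1 - d) ^+ k * #|T|%:R
    & (0 < k)%N -> d * #|T|%:R <= #|[set x | f x == 0%N]|%:R].
Proof.
move=> d0 d1 dP; elim=> [|k [f [fk fQ fU f0]]].
  exists (fun=> 0%N); split=> //.
  by rewrite expr0 mul1r ler_nat max_card.
set U := [set x | f x == k] in fU.
have [S [SU Sd SQ]] := dP U.
pose f' x := if x \in U :\: S then k.+1 else f x.
have low i : (i < k)%N -> [set x | f' x == i] = [set x | f x == i].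
  move=> ik; apply/setP => x; rewrite !inE /f' !inE.
  by case: ifP => // /andP[_ /eqP ->]; lia.
have mid : [set x | f' x == k] = S.
  apply/setP => x; rewrite !inE /f' !inE.
  have [xS|xS] /= := boolP (x \in S).
    by have := subsetP SU x xS; rewrite inE.
  by case: ifP => [_|->//]; lia.
have top : [set x | f' x == k.+1] = U :\: S.
  apply/setP => x; rewrite !inE /f' !inE.
  by case: ifP => [|_]; [rewrite eqxx|have := fk x; lia].
exists f'; split.
- by move=> x; rewrite /f'; case: ifP => // _; apply: leqW.
- move=> i; rewrite ltnS leq_eqVlt => /orP[/eqP ->|ik]; first by rewrite mid.
  by rewrite low //; apply: fQ.
- rewrite top cardsD (setIidPr SU) natrB ?subset_leq_card //.
  rewrite exprS -mulrA; apply: le_trans (_ : (1 - d) * #|U|%:R <= _).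
    by rewrite mulrBl mul1r lerB.
  by rewrite ler_wpM2l // subr_ge0.
- move=> _; have [k0|k0] := posnP k; last by rewrite low //; apply: f0.
  move: mid; rewrite k0 => ->; apply: le_trans Sd; rewrite (_ : U = setT) ?cardsT //.
  by apply/setP => x; rewrite !inE; have := fk x; lia.
Qed.

(** With [a], [b] the two sizes, pairs meeting [B] number at most [a b + b (a + b)], and
    [b <= eps a] bounds both terms. *)
Lemma merge_small (R : realFieldType) (T : finType) (e : rel T) (eps : R)
    (A B : {set T}) :
  0 <= eps -> [disjoint A & B] -> (cnt e A A)%:R <= eps * #|A|%:R ^+ 2 ->
  #|B|%:R <= eps * #|A|%:R ->
  (cnt e (A :|: B) (A :|: B))%:R <= 3 * eps * #|A :|: B|%:R ^+ 2.
Proof.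
move=> e0 dAB cA BA.
have cU : #|A :|: B| = (#|A| + #|B|)%N.
  by have := cardsUI A B; rewrite (disjoint_setI0 dAB) cards0; lia.
have : (cnt e (A :|: B) (A :|: B) <=
    cnt e A A + #|A| * #|B| + #|B| * #|A :|: B|)%N.
  rewrite cntUl // (cntUr _ A) //.
  by rewrite !leq_add // ?cnt_le_mul.
rewrite -(ler_nat R) !natrD !natrM cU natrD.
move: cA BA (ler0n R #|A|) (ler0n R #|B|).
set a := #|A|%:R; set b := #|B|%:R; set u : R := (cnt e A A)%:R; set v := _%:R.
move=> cA BA a0 b0 cv; apply: le_trans cv _.
have h1 : b * a <= eps * a * a by apply: ler_wpM2r.
have h2 : b * (a + b) <= eps * a * (a + b) by apply: ler_wpM2r => //; lra.
have h3 : 0 <= eps * a * b by rewrite !mulr_ge0.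
have h4 : 0 <= eps * b * b by rewrite !mulr_ge0.
lra.
Qed.

(** This bounds the leftover fraction by [1 / (k d)], so a [k] polynomial in [1 / d] suffices. *)
Lemma bernoulli_decay (R : realFieldType) (d : R) k :
  0 <= d -> d <= 1 -> (1 - d) ^+ k * (1 + k%:R * d) <= 1.
Proof.
move=> d0 d1; elim: k => [|k IH]; first by rewrite expr0; lra.
have k0 : 0 <= k%:R :> R by [].
have p0 : 0 <= (1 - d) ^+ k by rewrite exprn_ge0 // subr_ge0.
apply: le_trans IH; rewrite exprSr -(natr1 k) -mulrA; apply: ler_wpM2l => //.
have : 0 <= d * d by rewrite mulr_ge0.
have : 0 <= k%:R * (d * d) by rewrite !mulr_ge0.
lra.
Qed.

Lemma colouring_partition (T : finType) (f : T -> nat) k (Q : {set T} -> Prop) :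
  (forall x, (f x < k)%N) ->
  (forall i, [set x | f x == i] != set0 -> Q [set x | f x == i]) ->
  exists P : {set {set T}}, [/\ partition P [set: T], (#|P| <= k)%N
    & forall S, S \in P -> Q S].
Proof.
move=> fk fQ; exists (preim_partition f setT); split.
- exact: preim_partitionP.
- pose F (i : 'I_k) := [set x | f x == i].
  apply: leq_trans (_ : #|F @: setT| <= k)%N.
    apply: subset_leq_card; apply/subsetP => S /imsetP[x _ ->].
    apply/imsetP; exists (Ordinal (fk x)) => //.
    by apply/setP => y; rewrite !inE eq_sym.
  by apply: leq_trans (leq_imset_card _ _) _; rewrite cardsT card_ord.
- move=> S /imsetP[x _ ->].
  have -> : [set y in setT | f x == f y] = [set y | f y == f x].
    by apply/setP => y; rewrite !inE eq_sym.
  by apply: fQ; apply/set0Pn; exists x; rewrite inE.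
Qed.

(* Remove restricted sets greedily until the leftover is an [eps]-fraction of
   the first one, then merge the leftover into the first one. *)
Lemma restricted_partition (R : realFieldType) (G : sgraph) (eps d : R) (k : nat) :
  0 < eps -> 0 < d -> d <= 1 -> 1 <= eps * d * d * k%:R ->
  (forall U : {set G}, exists S : {set G},
     [/\ S \subset U, d * #|U|%:R <= #|S|%:R &
      exists b, (cnt (col_edge b) S S)%:R <= eps * #|S|%:R ^+ 2]) ->
  exists P : {set {set G}}, [/\ partition P [set: G], (#|P| <= k)%N
    & forall S, S \in P ->
      exists b, (cnt (col_edge b) S S)%:R <= 3 * eps * #|S|%:R ^+ 2].
Proof.
move=> e0 d0 d1 kb dP.
have k0 : (0 < k)%N by rewrite lt0n; apply: contraTneq kb => ->; rewrite mulr0 -ltNge ltr01.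
have [f [fk fQ fU f0]] := greedy_colouring d0 d1 dP k.
set U := [set x | f x == k] in fU; set A := [set x | f x == 0%N] in f0.
have small : (1 - d) ^+ k <= eps * d.
  have p0 : 0 <= (1 - d) ^+ k by rewrite exprn_ge0 // subr_ge0.
  have kd : 0 < k%:R * d by rewrite mulr_gt0 // ltr0n.
  rewrite -(ler_pM2r kd); have := bernoulli_decay k (ltW d0) d1; lra.
have UA : #|U|%:R <= eps * #|A|%:R.
  apply: le_trans fU _; apply: le_trans (_ : eps * (d * #|G|%:R) <= _).
    by rewrite mulrA ler_wpM2r.
  by rewrite ler_pM2l // f0.
(* The leftover colour [k] is merged into colour 0, which leaves exactly [k] colours. *)
pose g x := if f x == k then 0%N else f x.
apply: (@colouring_partition _ g) => [x|i].
  by rewrite /g; have := fk x; case: (f x =P k); lia.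
move=> /set0Pn[x]; rewrite inE => gx.
have ik : (i < k)%N by move: gx; rewrite /g; have := fk x; case: (f x =P k); lia.
have [i0|i0] := posnP i.
  have -> : [set x | g x == i] = A :|: U.
    by apply/setP => y; rewrite !inE /g i0; case: (f y =P k); lia.
  have [b cb] := fQ 0%N k0; exists b; apply: merge_small => //; first exact: ltW.
  rewrite -setI_eq0; apply/eqP/setP => y; rewrite !inE; lia.
have -> : [set x | g x == i] = [set x | f x == i].
  by apply/setP => y; rewrite !inE /g; case: (f y =P k); lia.
have [b cb] := fQ i ik; exists b; apply: le_trans cb _.
by rewrite -mulrA; apply: ler_peMl; [rewrite mulr_ge0 ?exprn_ge0 // ltW|lra].
Qed.

(** * Choice of constants and the equivalence *)

(** Working at density [eps ^+ 4] absorbs a factor 2 from ordered pairs and 3 from merging. *)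
Lemma six_pow4_le (R : realFieldType) (eps : R) :
  0 < eps -> eps <= 1 / 2 -> 6 * eps ^+ 4 <= eps.
Proof.
move=> e0 e2; have h : eps * eps <= 1 / 4 by nra.
have : eps * (eps * eps) <= eps * (1 / 4) by rewrite ler_pM2l.
have : eps ^+ 4 = eps * (eps * (eps * eps)) by ring.
nra.
Qed.

Theorem theorem5 (R : realType) (H : sgraph) :
  (forall eps : R, 0 < eps ->
     exists N : nat, (1 <= N)%N /\ restricted_partitions H eps N%:R)
  /\
  (polynomial_rodl R H <->
   exists C : R, 0 < C /\
     forall eps : R, 0 < eps -> eps <= 1 / 2 ->
     restricted_partitions H eps ((1 / eps) `^ C)).
Proof.
split=> [eps e0|].
  (* Merging the leftover triples the density. *)
  have e3 : 0 < eps / 3 by rewrite divr_gt0.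
  have [d [d0 d1 dP]] := rodl H e3.
  have w0 : 0 < eps / 3 * d * d by rewrite !mulr_gt0 ?invr_gt0.
  pose k := (Num.truncn ((eps / 3 * d * d)^-1)).+1.
  exists k; split=> // G freeG.
  have [|P [Pp Pk PQ]] := @restricted_partition R G _ _ k e3 d0 d1 _ (dP G freeG).
    by rewrite -ler_pdivrMl // mulr1 ltW // truncnS_gt.
  exists P; split=> //; first by rewrite ler_nat.
  move=> S /PQ[b cb]; apply: (@cnt_weakly_restricted _ _ _ _ b).
  by apply: le_trans cb _; rewrite le_eqVlt; apply/orP; left; apply/eqP; field.
split=> -[C [C0 CP]]; last first.
  exists C; split=> // eps e0 e2 G freeG.
  have [P [Pp Pk PQ]] := CP eps e0 e2 G freeG.
  have [G0|] := posnP #|G|.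
    exists set0; split; last by rewrite G0 mulr0.
    apply: (@cnt_weakly_restricted _ _ _ _ true).
    by rewrite /cnt big_set0 mulr_ge0 // ?exprn_ge0 // ltW.
  move=> /card_gt0P[x _].
  have xP : pblock P x \in P by rewrite pblock_mem // (cover_partition Pp) inE.
  (* The largest of at most [(1 / eps) ^ C] classes has at least [eps ^ C * #|G|] vertices. *)
  have [S SP Smax] := @arg_maxnP _ (pblock P x) (mem P) (fun S => #|S|) xP.
  exists S; split; first exact: PQ.
  have GS : (#|G| <= #|P| * #|S|)%N.
    by rewrite -cardsT (card_partition Pp) -sum_nat_const; apply: leq_sum.
  have eC : 0 < eps `^ C by rewrite powR_gt0.
  rewrite -ler_pdivlMl //; apply: le_trans (_ : #|P|%:R * #|S|%:R <= _).
    by rewrite -natrM ler_nat.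
  rewrite ler_wpM2r //; apply: le_trans Pk _.
  by rewrite div1r -(powR_inv1 (ltW e0)) -powRrM mulN1r powRN.
(* With density [eps^4] and fraction [d = eps^(4C)], about [1 / (eps^4 d^2)] classes arise, of
   exponent [4 + 8C]; one more power of [1 / eps] pays for rounding. *)
exists (5 + 8 * C); split; first by lra.
move=> eps e0 e2 G freeG.
pose w := eps ^+ 4; pose y := eps^-1; pose z := y `^ (4 * C).
have w0 : 0 < w by rewrite exprn_gt0.
have w6 : 6 * w <= eps by apply: six_pow4_le.
have y0 : 0 < y by rewrite invr_gt0.
have y2 : 2 <= y by rewrite -[2]invrK lef_pV2 ?posrE ?invr_gt0 //; lra.
have z1 : 1 <= z by rewrite -(powRr0 y) ler_powR //; lra.
have dE : w `^ C = z^-1.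
  by rewrite /w -powR_mulrn ?ltW // -powRrM /z /y -(powR_inv1 (ltW e0)) -powRrM mulN1r powRN invrK.
have NE : (1 / eps) `^ (5 + 8 * C) = y ^+ 5 * (z * z).
  rewrite div1r -/y -powR_mulrn ?ltW // /z -!powRD; first by congr (_ `^ _); ring.
  - by apply/implyP => _; rewrite gt_eqF.
  - by apply/implyP => _; rewrite gt_eqF.
have d0 : 0 < z^-1 by rewrite invr_gt0; lra.
have d1 : z^-1 <= 1 by rewrite invf_le1 //; lra.
have w2 : 0 < 2 * w by lra.
pose x := y ^+ 4 * (z * z).
have x1 : 1 <= x.
  have y4 : 1 <= y ^+ 4 by rewrite exprn_ege1 //; lra.
  have zz : 1 <= z * z by rewrite mulr_ege1.
  by rewrite /x mulr_ege1.
pose k := (Num.truncn x).+1.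
have [||P [Pp Pk PQ]] := @restricted_partition R G (2 * w) z^-1 k w2 d0 d1.
- have xE : 2 * w * z^-1 * z^-1 * x = 2.
    by rewrite /x /w /y; field; rewrite !gt_eqF //; lra.
  have := truncnS_gt x; rewrite -/k => /ltW xk.
  have c0 : 0 <= 2 * w * z^-1 * z^-1 by rewrite !mulr_ge0 // ltW.
  have := ler_wpM2l c0 xk; rewrite xE; lra.
- move=> U; have w12 : w <= 1 / 2 by lra.
  have [S [Sw Sd]] := CP w w0 w12 (induced U) (free_induced freeG).
  exists (val @: S); split.
  + by apply/subsetP => v /imsetP[u _ ->]; apply: valP.
  + by move: Sd; rewrite dE card_sig card_imset //; apply: val_inj.
  + have [b cb] := weakly_restricted_cnt Sw; exists b.
    by rewrite cnt_col_induced card_imset //; apply: val_inj.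
exists P; split=> //.
  apply: le_trans (_ : k%:R <= _); first by rewrite ler_nat.
  (* Rounding is absorbed by [x + 1 <= 2 x <= y x], as [x >= 1] and [y >= 2]. *)
  have kx : k%:R <= x + 1.
    have /andP[tx _] := truncn_itv (le_trans ler01 x1).
    by rewrite /k -natr1 lerD2r.
  have : 2 * x <= y * x by rewrite ler_wpM2r //; lra.
  have -> : (1 / eps) `^ (5 + 8 * C) = y * x by rewrite NE /x; ring.
  lra.
move=> S /PQ[b cb]; apply: (@cnt_weakly_restricted _ _ _ _ b).
apply: le_trans cb _; rewrite ler_wpM2r ?exprn_ge0 //; lra.
Qed.
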